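(* The threshold for $[2,n]_p$ to contain a product Schur triple is $(n\log n)^{-1/3}$. That is, if $p=p(n)$ satisfies $p=o\big((n\log n)^{-1/3}\big)$ then $\Pr{[2,n]_p \text{ contains } a,b,c \text{ with } ab=c}\to 0$, and if $(n\log n)^{-1/3}=o(p)$ then this probability tends to $1$, as $n\to\infty$.
   Context: $[2,n]=\{2,\dots,n\}$. For a set $A\subseteq\mathbb{N}$ and $p\in[0,1]$, $A_p$ denotes the random subset of $A$ obtained by including each element independently with probability $p$. A product Schur triple is a triple of integers $a,b,c$ (not necessarily distinct) with $ab=c$; $[2,n]_p$ contains one if there are $a,b,c\in[2,n]_p$ with $ab=c$. *)

(* Defs.v *)
From mathcomp Require Import all_boot all_order all_algebra.
From mathcomp Require Import all_classical all_reals all_analysis.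
Import Order.TTheory GRing.Theory Num.Theory.
Import numFieldNormedType.Exports.

Set Implicit Arguments.
Unset Strict Implicit.
Unset Printing Implicit Defensive.

Local Open Scope ring_scope.
Local Open Scope classical_set_scope.

(* The probability that the random subset [A_p] satisfies [E]: each subset [B]
   of [A] has weight [p] for every element of [A] it contains, and [1 - p] for
   every element of [A] it misses. *)
Definition prob_random_subset (R : realType) (T : finType) (A : {set T})
    (p : R) (E : pred {set T}) : R :=
  \sum_(B in powerset A | E B) \prod_(x in A) (if x \in B then p else 1 - p).

Definition interval2 (n : nat) : {set 'I_n.+1} :=
  [set i : 'I_n.+1 | (2 <= i)%N]%SET.

Definition has_product_schur_triple (n : nat) (B : {set 'I_n.+1}) : bool :=
  [exists a in B, exists b in B, exists c in B, (a * b)%N == c :> nat].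

(* Main.v *)
(* The 0-statement is a union bound over the pairs (a, b) with a b <= n, of which
   there are at most n log n; the at most sqrt n triples (a, a, a^2) are negligible.
   For the 1-statement, let k^6 <= n < (k + 1)^6 and keep only the triples with
   k^2 <= a < k^3 < b and a b <= k^6.  There are still N >> n log n of them, two
   distinct ones share at most one element, and each one meets at most 3 k^4
   others.  Hence the second moment method gives
   Pr(no triple) <= 1 / (N p^3) + 3 k^4 / (N p), and both terms tend to 0. *)
Require Import Defs.
From mathcomp Require Import all_boot all_order all_algebra.
From mathcomp Require Import all_classical all_reals all_analysis.
From mathcomp Require Import ring lra zify.
Import Order.TTheory GRing.Theory Num.Theory.
Import numFieldNormedType.Exports.

Set Implicit Arguments.
Unset Strict Implicit.
Unset Printing Implicit Defensive.

Local Open Scope ring_scope.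
Local Open Scope classical_set_scope.

(** * Random subsets: containment probabilities, union bound, second moment *)

(** Expand the product of the [F x + G x] by distributivity, choosing [F x] for [x] in [B] and [G x]
    otherwise. Since [G] vanishes on [S] and [F] vanishes off [A], only the sets between [S] and [A]
    survive, each with its own weight; the factors on [S] add up to [p], all others to 1. *)
Lemma sum_random_subset_superset (R : realType) (T : finType) (A S : {set T})
    (p : R) : S \subset A ->
  \sum_(B in powerset A)
     (\prod_(x in A) (if x \in B then p else 1 - p)) * (S \subset B)%:R
  = p ^+ #|S|.
Proof.
move=> sSA.
pose F x := if x \in A then p else 0.
pose G x := if x \in S then 0 else if x \in A then 1 - p else 1.
have -> : p ^+ #|S| = \prod_x (F x + G x).
  rewrite -prodr_const [RHS](bigID (mem S)) /= [X in _ = _ * X]big1 ?mulr1.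
    by apply: eq_bigr => x xS; rewrite /F /G xS (fintype.subsetP sSA) // addr0.
  move=> x /negbTE xS; rewrite /F /G xS; case: ifP => _; last by rewrite add0r.
  by rewrite addrC subrK.
rewrite bigA_distr [RHS](bigID (mem (powerset A))) /= [X in _ = _ + X]big1 ?addr0.
  apply: eq_big => [B|B]; first by [].
  rewrite powersetE => sBA.
  have [sSB|nsSB] := boolP (S \subset B); last first.
    rewrite mulr0; have [x xS xB] := fintype.subsetPn nsSB.
    by rewrite (bigD1 x) //= (negbTE xB) /G xS mul0r.
  rewrite mulr1 [RHS](bigID (mem A)) /= [X in _ = _ * X]big1 ?mulr1.
    apply: eq_bigr => x xA; rewrite /F /G xA.
    by case: ifPn => // /(contra (fintype.subsetP sSB x))/negbTE ->.
  move=> x xA; have xB := contra (fintype.subsetP sBA x) xA.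
  have xS := contra (fintype.subsetP sSA x) xA.
  by rewrite /F /G (negbTE xB) (negbTE xS) (negbTE xA).
move=> B; rewrite powersetE => /fintype.subsetPn[x xB xA].
by rewrite (bigD1 x) //= xB /F (negbTE xA) mul0r.
Qed.

Lemma random_subset_weight_ge0 (R : realType) (T : finType) (A B : {set T})
    (p : R) : 0 <= p <= 1 ->
  0 <= \prod_(x in A) (if x \in B then p else 1 - p).
Proof.
move=> /andP[p0 p1]; apply: prodr_ge0 => x _.
by case: ifP => // _; rewrite subr_ge0.
Qed.

Lemma prob_random_subset_sum (R : realType) (T : finType) (A : {set T})
    (p : R) (E : pred {set T}) :
  prob_random_subset A p E =
  \sum_(B in powerset A)
     (\prod_(x in A) (if x \in B then p else 1 - p)) * (E B)%:R.
Proof.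
rewrite /prob_random_subset big_mkcondr; apply: eq_bigr => B _.
by case: (E B); rewrite ?mulr1 ?mulr0.
Qed.

Lemma prob_random_subset_ge0 (R : realType) (T : finType) (A : {set T})
    (p : R) (E : pred {set T}) : 0 <= p <= 1 -> 0 <= prob_random_subset A p E.
Proof. by move=> hp; apply: sumr_ge0 => B _; exact: random_subset_weight_ge0. Qed.

Lemma prob_random_subsetT (R : realType) (T : finType) (A : {set T}) (p : R) :
  \sum_(B in powerset A) (\prod_(x in A) (if x \in B then p else 1 - p)) = 1.
Proof.
have := @sum_random_subset_superset R T A finset.set0 p (finset.sub0set A).
rewrite cards0 expr0; apply: etrans.
by apply: eq_bigr => B _; rewrite finset.sub0set mulr1.
Qed.

Lemma prob_random_subsetC (R : realType) (T : finType) (A : {set T})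
    (p : R) (E : pred {set T}) :
  prob_random_subset A p E = 1 - prob_random_subset A p (fun B => ~~ E B).
Proof.
apply/eqP; rewrite eq_sym subr_eq -(prob_random_subsetT A p) !prob_random_subset_sum.
rewrite -big_split /=; apply/eqP/eq_bigr => B _.
by rewrite -mulrDr; case: (E B); rewrite /= ?addr0 ?add0r mulr1.
Qed.

Lemma prob_random_subset_le (R : realType) (T : finType) (A : {set T})
    (p : R) (E E' : pred {set T}) : 0 <= p <= 1 ->
  (forall B : {set T}, B \subset A -> E B -> E' B) ->
  prob_random_subset A p E <= prob_random_subset A p E'.
Proof.
move=> hp EE'; rewrite !prob_random_subset_sum; apply: ler_sum => B.
rewrite powersetE => BA; apply: ler_wpM2l; first exact: random_subset_weight_ge0.
by rewrite ler_nat; case: (boolP (E B)) => // /(EE' _ BA) ->.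
Qed.

Lemma prob_random_subset_union_bound (R : realType) (T I : finType)
    (A : {set T}) (p : R) (P : {set I}) (f : I -> {set T}) : 0 <= p <= 1 ->
  (forall i, i \in P -> f i \subset A) ->
  prob_random_subset A p (fun B => [exists i in P, f i \subset B])
  <= \sum_(i in P) p ^+ #|f i|.
Proof.
move=> hp fA; rewrite prob_random_subset_sum.
under [leRHS]eq_bigr => i iP do rewrite -(sum_random_subset_superset p (fA i iP)).
rewrite exchange_big /=; apply: ler_sum => B _.
rewrite -mulr_sumr; apply: ler_wpM2l; first exact: random_subset_weight_ge0.
case: exists_inP => [[i iP fiB]|_]; last by apply: sumr_ge0.
by rewrite (bigD1 i iP) /= fiB lerDl; apply: sumr_ge0.
Qed.

(* Chebyshev's inequality Pr(X = 0) * (E X)^2 <= Var X for the number X of indices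
   [i] with [f i] included in the random set: disjoint sets have covariance 0,
   and two distinct intersecting ones have a union of size 5. *)
Lemma prob_random_subset_second_moment (R : realType) (T I : finType)
    (A : {set T}) (p : R) (P : {set I}) (f : I -> {set T}) (D : nat) :
  0 <= p <= 1 ->
  (forall i, i \in P -> f i \subset A) ->
  (forall i, i \in P -> #|f i| = 3%N) ->
  (forall i j, i \in P -> j \in P -> i != j -> (#|f i :&: f j| <= 1)%N) ->
  (forall i, i \in P -> (#|[set j in P | f i :&: f j != finset.set0]| <= D)%N) ->
  prob_random_subset A p (fun B => ~~ [exists i in P, f i \subset B])
    * (#|P|%:R * p ^+ 3) ^+ 2
  <= #|P|%:R * p ^+ 3 + #|P|%:R * D%:R * p ^+ 5.
Proof.
move=> hp fA f3 fI fD; have /andP[p0 p1] := hp.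
pose w (B : {set T}) := \prod_(x in A) (if x \in B then p else 1 - p).
pose X (B : {set T}) : R := \sum_(i in P) (f i \subset B)%:R.
have w0 (B : {set T}) : 0 <= w B by exact: random_subset_weight_ge0.
set mu := #|P|%:R * p ^+ 3.
have EX : \sum_(B in powerset A) w B * X B = mu.
  under eq_bigr => B _ do rewrite mulr_sumr.
  rewrite exchange_big /= /mu mulr_natl -sumr_const.
  by apply: eq_bigr => i iP; rewrite sum_random_subset_superset ?f3 ?fA.
have EX2 : \sum_(B in powerset A) w B * X B ^+ 2
           = \sum_(i in P) \sum_(j in P) p ^+ #|f i :|: f j|.
  under eq_bigr => B _.
    rewrite expr2 mulr_suml mulr_sumr.
    under eq_bigr => i _ do rewrite mulr_sumr mulr_sumr.
    over.
  rewrite exchange_big /=; apply: eq_bigr => i iP.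
  rewrite exchange_big /=; apply: eq_bigr => j jP.
  rewrite -(@sum_random_subset_superset _ _ A) ?finset.subUset ?fA //.
  by apply: eq_bigr => B _; rewrite finset.subUset -natrM mulnb.
(* The terms account for [j = i], for the at most [D] sets meeting [f i] (union of size at least 5),
   and for disjoint sets. Granting [p ^+ 6] to every [j] makes the last terms add up over [i] to
   exactly [mu ^+ 2], which the variance subtracts. *)
have cov i : i \in P -> \sum_(j in P) p ^+ #|f i :|: f j|
    <= p ^+ 3 + D%:R * p ^+ 5 + #|P|%:R * p ^+ 6.
  move=> iP; pose Q := [set j in P | f i :&: f j != finset.set0].
  apply: (@le_trans _ _ (\sum_(j in P) ((j == i)%:R * p ^+ 3
            + (j \in Q)%:R * p ^+ 5 + p ^+ 6))).
    apply: ler_sum => j jP; have [->|ji] := eqVneq j i.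
      by rewrite finset.setUid f3 // mul1r -addrA lerDl addr_ge0 ?mulr_ge0 ?exprn_ge0.
    rewrite mul0r add0r inE jP /= cardsU !f3 //.
    have [->|nI] := eqVneq (f i :&: f j) finset.set0.
      by rewrite cards0 mul0r add0r.
    rewrite mul1r; apply: ler_wpDr; first exact: exprn_ge0.
    by apply: ler_wiXn2l => //; have := fI _ _ iP jP; rewrite eq_sym ji => /(_ isT); lia.
  rewrite !big_split /=; apply: lerD; last first.
    by rewrite sumr_const mulr_natl.
  rewrite -!mulr_suml; apply: lerD.
    rewrite (bigD1 i) //= eqxx big1 ?addr0 ?mul1r // => j /andP[_ /negbTE ->] //.
  apply: ler_wpM2r; first exact: exprn_ge0.
  rewrite -natr_sum ler_nat; apply: leq_trans (fD i iP).
  rewrite -sum1_card big_mkcond [leqRHS]big_mkcond /=; apply: leq_sum => j _.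
  by rewrite /Q inE; case: (j \in P) => //=; case: (_ == _).
(* On the event, [X B] is 0 and the squared deviation equals [mu ^+ 2]; elsewhere it is
   nonnegative. *)
apply: (@le_trans _ _ (\sum_(B in powerset A) w B * (X B - mu) ^+ 2)).
  rewrite prob_random_subset_sum mulr_suml; apply: ler_sum => B _.
  rewrite -mulrA; apply: (ler_wpM2l (w0 B)).
  have [_|nE] := boolP [exists i in P, f i \subset B].
    by rewrite mul0r sqr_ge0.
  suff -> : X B = 0 by rewrite /= sub0r sqrrN mul1r.
  apply: big1 => i iP; case: (boolP (_ \subset _)) => // sB.
  by case/exists_inP: nE; exists i.
have -> : \sum_(B in powerset A) w B * (X B - mu) ^+ 2 =
    \sum_(B in powerset A) w B * X B ^+ 2 - mu ^+ 2.
  (* Writing [mu ^+ 2] through the expectations of [X] and of 1 lets both sides be compared term by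
     term in [B]. *)
  have -> : mu ^+ 2 = mu * (\sum_(B in powerset A) w B * X B) *+ 2
      - mu ^+ 2 * \sum_(B in powerset A) w B.
    by rewrite EX prob_random_subsetT; ring.
  rewrite opprB addrA -mulrnAr -sumrMnl !mulr_sumr -big_split -sumrB /=.
  by apply: eq_bigr => B _; ring.
rewrite EX2 lerBlDr; apply: (le_trans (ler_sum _ cov)).
rewrite sumr_const -mulr_natl /mu le_eqVlt; apply/orP; left; apply/eqP; ring.
Qed.

(** * Harmonic sums and counting tools *)

(** Both bounds are [ln (1 + x) <= x], taken at [x = - 1 / (k + 1)] and at [x = 1 / k]. *)
Lemma ln_succ_sub_bounds (R : realType) (k : nat) : (0 < k)%N ->
  k.+1%:R^-1 <= ln (k.+1%:R : R) - ln k%:R <= k%:R^-1.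
Proof.
move=> k0; have k0R : 0 < k%:R :> R by rewrite ltr0n.
have k1R : 0 < k.+1%:R :> R by rewrite ltr0n.
have kS : k.+1%:R = k%:R + 1 :> R by rewrite -natr1.
apply/andP; split.
  rewrite -lerN2 opprB -ln_div ?posrE //.
  have -> : k%:R / k.+1%:R = 1 + - k.+1%:R^-1 :> R.
    by rewrite -[X in X - _](@mulfV _ k.+1%:R) ?gt_eqF // -[X in _ - X]mul1r -mulrBl kS addrK.
  apply: le_ln1Dx; rewrite ltrN2 invf_lt1 // ltr1n; lia.
rewrite -ln_div ?posrE // kS mulrDl mulfV ?gt_eqF // mul1r.
by apply: le_ln1Dx; rewrite (lt_trans (ltrN10 R)) // invr_gt0.
Qed.

Lemma sum_inv_succ_le_ln (R : realType) (m n : nat) : (0 < m <= n)%N ->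
  \sum_(m <= k < n) k.+1%:R^-1 <= ln n%:R - ln m%:R :> R.
Proof.
move=> /andP[m0 mn]; rewrite -(telescope_sumr (fun k => ln (k%:R : R)) mn).
apply: ler_sum_nat => k /andP[mk _].
by have /andP[] := ln_succ_sub_bounds R (leq_trans m0 mk).
Qed.

Lemma ln_le_sum_inv (R : realType) (m n : nat) : (0 < m <= n)%N ->
  ln n%:R - ln m%:R <= \sum_(m <= k < n) k%:R^-1 :> R.
Proof.
move=> /andP[m0 mn]; rewrite -(telescope_sumr (fun k => ln (k%:R : R)) mn).
apply: ler_sum_nat => k /andP[mk _].
by have /andP[] := ln_succ_sub_bounds R (leq_trans m0 mk).
Qed.

Lemma exists_nat_root (m n : nat) : (0 < m)%N ->
  exists k, (k ^ m <= n < k.+1 ^ m)%N.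
Proof.
move=> m0.
have ex : exists k, (k ^ m <= n)%N by exists 0%N; rewrite exp0n.
have ub k : (k ^ m <= n)%N -> (k <= n)%N.
  apply: leq_trans; case: k => // k; rewrite -[leqLHS]expn1.
  by rewrite leq_pexp2l.
exists (ex_maxn ex ub); case: ex_maxnP => k -> /= kmax.
by rewrite ltnNge; apply/negP => /kmax; rewrite ltnn.
Qed.

Lemma card_ord_range (N l u : nat) :
  #|[set a : 'I_N | (l < a <= u)%N]%SET| = (minn u.+1 N - l.+1)%N.
Proof.
rewrite -sum1dep_card big_mkcond /=.
elim: N => [|N IH]; first by rewrite big_ord0; lia.
by rewrite big_ord_recr /= IH; case: ifP; lia.
Qed.

Lemma card_le_inj_range (T : finType) (N m : nat) (S : {set T}) (g : T -> 'I_N) :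
  {in S &, injective g} -> (forall x, x \in S -> (0 < g x <= m)%N) ->
  (#|S| <= m)%N.
Proof.
move=> injg gS; rewrite -(card_in_imset injg).
apply: (@leq_trans #|[set a : 'I_N | (0 < a <= m)%N]%SET|); last first.
  by rewrite card_ord_range; lia.
by apply/subset_leq_card/fintype.subsetP => i /imsetP[x xS ->]; rewrite inE gS.
Qed.

Lemma card_set_pairs (S T : finType) (Q : S -> T -> bool) :
  #|[set x : S * T | Q x.1 x.2]%SET| = (\sum_a #|[set b | Q a b]%SET|)%N.
Proof.
rewrite -sum1dep_card; under [RHS]eq_bigr => a _ do rewrite -sum1dep_card.
by rewrite pair_big_dep.
Qed.

Lemma sum_ord_range (V : nmodType) (l u N : nat) (F : nat -> V) : (u <= N)%N ->
  \sum_(a < N | (l <= a < u)%N) F a = \sum_(l <= a < u) F a.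
Proof.
move=> uN; rewrite (big_nat_widen _ _ _ _ _ uN) (big_nat_widenl _ 0%N) // big_mkord.
by apply: eq_bigl => a; rewrite andTb andbC.
Qed.

(** * Product Schur triples and the first moment bound *)

Definition schur_pairs (n : nat) : {set 'I_n.+1 * 'I_n.+1} :=
  [set x : 'I_n.+1 * 'I_n.+1 | [&& 2 <= x.1, 2 <= x.2 & x.1 * x.2 <= n]]%N%SET.

(** [inord] defaults to 0 when the product exceeds [n], so this is the intended triple only for
    pairs whose product is at most [n]. *)
Definition schur_triple (n : nat) (x : 'I_n.+1 * 'I_n.+1) : {set 'I_n.+1} :=
  [set x.1; x.2; inord (x.1 * x.2)]%SET.

(** Each [a] admits at most [n / a] values of [b]. As [a] starts at 2, the sum of the [1 / a] is at
    most [ln n], with no additive constant. *)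
Lemma card_schur_pairs (R : realType) (n : nat) : (0 < n)%N ->
  #|schur_pairs n|%:R <= n%:R * ln n%:R :> R.
Proof.
move=> n0; rewrite /schur_pairs.
rewrite (@card_set_pairs _ _ (fun a b : 'I_n.+1 => [&& 2 <= a, 2 <= b & a * b <= n]%N)).
rewrite natr_sum.
apply: (@le_trans _ _ (\sum_(a < n.+1 | (2 <= a < n.+1)%N) n%:R * a%:R^-1)).
  rewrite [leRHS]big_mkcond; apply: ler_sum => a _ /=; rewrite ltn_ord andbT.
  case: ifP => a2; last by rewrite (eq_card0 (A := _)) // => b; rewrite !inE.
  have a0 : 0 < a%:R :> R by rewrite ltr0n; lia.
  rewrite ler_pdivlMr // -natrM ler_nat.
  apply: leq_trans (leq_trunc_div n a); rewrite leq_mul2r; apply/orP; right.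
  have := card_ord_range n.+1 0 (n %/ a); rewrite subn1 => cE.
  apply: (@leq_trans #|[set b : 'I_n.+1 | (0 < b <= n %/ a)%N]%SET|).
    apply/subset_leq_card/fintype.subsetP => b; rewrite !inE => /and3P[_ b2 ab].
    by rewrite (leq_trans _ b2) //= leq_divRL 1?mulnC //; lia.
  by rewrite cE; lia.
rewrite (@sum_ord_range R 2 n.+1 n.+1 (fun a => n%:R * a%:R^-1)) // -mulr_sumr ler_wpM2l // big_add1 /=.
by rewrite (le_trans (@sum_inv_succ_le_ln R 1 n _)) // ln1 subr0.
Qed.

(** A diagonal pair is determined by its first coordinate, which is at most the integer square root
    [r] of [n]. *)
Lemma card_schur_diagonal (n : nat) :
  (#|[set x in schur_pairs n | x.1 == x.2]%SET| ^ 2 <= n)%N.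
Proof.
have [r /andP[rn nr]] := @exists_nat_root 2 n isT.
apply: leq_trans rn; rewrite leq_exp2r //.
apply: (@card_le_inj_range _ _ _ _ fst) => [x y|x] /finset.setIdP[xP /eqP xE].
  move=> /finset.setIdP[_ /eqP yE] xy.
  by rewrite (surjective_pairing x) (surjective_pairing y) -xE -yE xy.
move: xP; rewrite inE -xE => /and3P[a2 _ aa].
rewrite (leq_trans _ a2) //= -ltnS -(@ltn_exp2r _ _ 2) //.
by apply: leq_ltn_trans nr; rewrite expnS expn1.
Qed.

(** With both factors at least 2, the product exceeds each of them, so only the two factors can
    coincide; the boolean, read as 0 or 1, records whether they differ. *)
Lemma card_schur_triple (n : nat) (x : 'I_n.+1 * 'I_n.+1) :
  x \in schur_pairs n -> #|schur_triple x| = (x.1 != x.2).+2.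
Proof.
case: x => a b; rewrite inE /= => /and3P[a2 b2 ab]; rewrite /schur_triple /=.
have cE : (inord (a * b) : 'I_n.+1) = (a * b)%N :> nat by rewrite inordK.
rewrite finset.setUC cardsU1 cards2 !inE negb_or.
have -> : (inord (a * b) : 'I_n.+1) != a by apply/eqP => /(congr1 val) /=; rewrite cE; nia.
have -> : (inord (a * b) : 'I_n.+1) != b by apply/eqP => /(congr1 val) /=; rewrite cE; nia.
by [].
Qed.

Lemma schur_triple_sub (n : nat) (x : 'I_n.+1 * 'I_n.+1) :
  x \in schur_pairs n -> schur_triple x \subset interval2 n.
Proof.
case: x => a b; rewrite inE /= => /and3P[a2 b2 ab]; rewrite /schur_triple /=.
apply/fintype.subsetP => i; rewrite !inE => /orP[/orP[]|] /eqP -> //.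
by rewrite inordK //; nia.
Qed.

(** Puts the event in the form of a union of containment events, to which both moment bounds
    apply. *)
Lemma has_product_schur_tripleE (n : nat) (B : {set 'I_n.+1}) :
  B \subset interval2 n ->
  has_product_schur_triple B = [exists x in schur_pairs n, schur_triple x \subset B].
Proof.
move=> /fintype.subsetP BA; apply/exists_inP/exists_inP => [[a aB]|[[a b]]].
  move=> /exists_inP[b bB /exists_inP[c cB /eqP abc]].
  have := BA _ aB; have := BA _ bB; rewrite !inE => b2 a2.
  have cn : (a * b <= n)%N by rewrite abc -ltnS.
  exists (a, b); first by rewrite inE /= a2 b2 cn.
  rewrite /schur_triple /= !finset.subUset !finset.sub1set aB bB /=.
  by have -> : inord (a * b) = c by apply: val_inj; rewrite /= inordK.
rewrite inE /= => /and3P[a2 b2 ab].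
rewrite /schur_triple /= !finset.subUset !finset.sub1set => /andP[/andP[aB bB] cB].
exists a => //; apply/exists_inP; exists b => //; apply/exists_inP.
by exists (inord (a * b)); rewrite // inordK.
Qed.

(* [s] counts the degenerate triples [a * a = c], which have only two elements. *)
Lemma prob_product_schur_triple_le (R : realType) (n : nat) (p : R) :
  (0 < n)%N -> 0 <= p <= 1 -> exists2 s : nat, (s ^ 2 <= n)%N &
  prob_random_subset (interval2 n) p (@has_product_schur_triple n)
  <= n%:R * ln n%:R * p ^+ 3 + s%:R * p ^+ 2.
Proof.
move=> n0 hp; have /andP[p0 p1] := hp.
exists #|[set x in schur_pairs n | x.1 == x.2]%SET|.
  exact: card_schur_diagonal.
apply: (@le_trans _ _ (\sum_(x in schur_pairs n) p ^+ #|schur_triple x|)).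
  apply: le_trans (prob_random_subset_union_bound hp (@schur_triple_sub n)).
  by apply: prob_random_subset_le => // B BA; rewrite has_product_schur_tripleE.
rewrite (bigID (fun x => x.1 != x.2)) /=; apply: lerD.
  apply: (@le_trans _ _ (\sum_(x in schur_pairs n) p ^+ 3)).
    rewrite [leRHS](bigID (fun x => x.1 != x.2)) /=; apply: ler_wpDr.
      by apply: sumr_ge0 => *; exact: exprn_ge0.
    by apply: ler_sum => x /andP[xP xx]; rewrite card_schur_triple // xx.
  rewrite sumr_const -(mulr_natl (p ^+ 3)); apply: ler_wpM2r; first exact: exprn_ge0.
  exact: card_schur_pairs.
rewrite mulr_natl -sumr_const le_eqVlt; apply/orP; left; apply/eqP.
apply: eq_big => [x|x /andP[xP /negbNE xx]]; first by rewrite !inE negbK.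
by rewrite card_schur_triple // xx.
Qed.

(** * Tripartite triples: structure, count and second moment bound *)

(* The ranges [k^2, k^3), (k^3, k^4] and (k^4, k^6] of [a], [b] and [a * b] are
   disjoint, so an element of a triple determines its role in the triple.  The
   lower bound on [a] discards the small numbers, whose many multiples would make the
   variance too large. *)
Definition tripartite_pairs (n k : nat) : {set 'I_n.+1 * 'I_n.+1} :=
  [set x : 'I_n.+1 * 'I_n.+1 |
    [&& k ^ 2 <= x.1, x.1 < k ^ 3, k ^ 3 < x.2 & x.1 * x.2 <= k ^ 6]]%N%SET.

(** From [k^2 b <= a b <= k^6] one gets [b <= k^4], and [a b >= k^2 (k^3 + 1) > k^4]. *)
Lemma tripartite_pairsP (n k : nat) (x : 'I_n.+1 * 'I_n.+1) :
  (2 <= k)%N -> (k ^ 6 <= n)%N -> x \in tripartite_pairs n k ->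
  [/\ (2 <= x.1 < k ^ 3)%N, (k ^ 3 < x.2 <= k ^ 4)%N & (k ^ 4 < x.1 * x.2 <= n)%N].
Proof.
move=> k2 kn; rewrite inE => /and4P[a1 a2 b1 ab].
have kk : (2 ^ 2 <= k ^ 2)%N by rewrite leq_exp2r.
have k3 : (0 < k ^ 3)%N by rewrite expn_gt0; lia.
have k2k3 : (k ^ 4 < k ^ 2 * (k ^ 3).+1)%N.
  have -> : (k ^ 4 = k ^ 2 * k ^ 2)%N by rewrite -expnD.
  by rewrite ltn_pmul2l ?ltnS ?leq_exp2l // expn_gt0; lia.
split.
- by rewrite a2 andbT; lia.
- rewrite b1 /= -(@leq_pmul2l (k ^ 2)) ?expn_gt0; last by lia.
  by rewrite -expnD; apply: leq_trans ab; rewrite leq_mul2r a1 orbT.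
- rewrite (leq_trans ab kn) andbT; apply: (leq_trans k2k3).
  by apply: leq_mul.
Qed.

Lemma tripartite_pairs_schur (n k : nat) : (2 <= k)%N -> (k ^ 6 <= n)%N ->
  tripartite_pairs n k \subset schur_pairs n.
Proof.
move=> k2 kn; apply/fintype.subsetP => x xP.
have [/andP[a1 a2] /andP[b1 b2] /andP[_ ab]] := tripartite_pairsP k2 kn xP.
by rewrite inE a1 ab andbT /=; lia.
Qed.

Lemma schur_tripleP (n : nat) (x : 'I_n.+1 * 'I_n.+1) (i : 'I_n.+1) :
  (x.1 * x.2 <= n)%N -> i \in schur_triple x ->
  [\/ i = x.1 :> nat, i = x.2 :> nat | i = (x.1 * x.2)%N :> nat].
Proof.
move=> xn; rewrite !inE => /orP[/orP[]|] /eqP ->; [exact: Or31|exact: Or32|].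
by apply: Or33; rewrite inordK.
Qed.

(** A common element plays the same role in both triples, so two distinct common elements yield two
    of the equations [a = c], [b = d], [a b = c d]. Any two of these make the pairs equal. *)
Lemma tripartite_pairs_linear (n k : nat) (x y : 'I_n.+1 * 'I_n.+1) :
  (2 <= k)%N -> (k ^ 6 <= n)%N ->
  x \in tripartite_pairs n k -> y \in tripartite_pairs n k -> x != y ->
  (#|schur_triple x :&: schur_triple y| <= 1)%N.
Proof.
move=> k2 kn xP yP xy; apply/card_le1_eqP => i j.
move=> /finset.setIP[ix iy] /finset.setIP[jx jy].
have [/andP[a2 a3] /andP[b3 b4] /andP[ab4 abn]] := tripartite_pairsP k2 kn xP.
have [/andP[c2 c3] /andP[d3 d4] /andP[cd4 cdn]] := tripartite_pairsP k2 kn yP.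
have ix' := schur_tripleP abn ix; have jx' := schur_tripleP abn jx.
have iy' := schur_tripleP cdn iy; have jy' := schur_tripleP cdn jy.
have nE : ~ ((x.1 = y.1 :> nat) /\ (x.2 = y.2 :> nat)).
  move=> [/val_inj E1 /val_inj E2]; case/eqP: xy.
  by rewrite (surjective_pairing x) E1 E2 -surjective_pairing.
apply: val_inj => /=; move: a2 a3 b3 b4 ab4 c2 c3 d3 d4 cd4 ix' jx' iy' jy' nE.
move: (val x.1) (val x.2) (val y.1) (val y.2) (k ^ 3)%N (k ^ 4)%N => /=.
move=> a b c d T1 T2 a2 a3 b3 b4 ab4 c2 c3 d3 d4 cd4 ix' jx' iy' jy' nE.
(* The nonlinear consequences are extracted first; the products then become atoms [u] and [v], and
   what remains is linear. *)
have abcd1 : a = c -> (a * b = c * d)%N -> b = d by nia.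
have abcd2 : b = d -> (a * b = c * d)%N -> a = c by nia.
move: (a * b)%N (c * d)%N ab4 cd4 ix' jx' iy' jy' abcd1 abcd2 => u v ab4 cd4.
move=> ix' jx' iy' jy' abcd1 abcd2.
have role l : [\/ l = a, l = b | l = u] -> [\/ l = c, l = d | l = v] ->
    [\/ l = a /\ a = c, l = b /\ b = d | l = u /\ u = v].
  clear -a2 a3 b3 b4 ab4 c2 c3 d3 d4 cd4.
  by case=> E; case=> E'; (try by exfalso; lia);
    [apply: Or31|apply: Or32|apply: Or33]; lia.
clear -role ix' jx' iy' jy' abcd1 abcd2 nE.
by case: (role _ ix' iy') => -[E E']; case: (role _ jx' jy') => -[F F']; lia.
Qed.

(** A neighbour shares the first factor, the second factor or the product. Fixing the first leaves
    at most [k^4] values of [b]; fixing either of the others leaves fewer than [k^3] values of [a],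
    which then determines the pair. *)
Lemma card_tripartite_neighbours (n k : nat) (x : 'I_n.+1 * 'I_n.+1) :
  (2 <= k)%N -> (k ^ 6 <= n)%N -> x \in tripartite_pairs n k ->
  (#|[set y in tripartite_pairs n k |
       schur_triple x :&: schur_triple y != finset.set0]%SET| <= 3 * k ^ 4)%N.
Proof.
move=> k2 kn xP.
have [xa xb /andP[xc xn]] := tripartite_pairsP k2 kn xP.
set P := tripartite_pairs n k.
pose Y1 := [set y in P | y.1 == x.1]%SET.
pose Y2 := [set y in P | y.2 == x.2]%SET.
pose Y3 := [set y in P | (y.1 * y.2 == x.1 * x.2)%N]%SET.
have sub : [set y in P | schur_triple x :&: schur_triple y != finset.set0]%SET
    \subset (Y1 :|: Y2 :|: Y3)%SET.
  apply/fintype.subsetP => y; rewrite inE => /andP[yP /set0Pn[i]].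
  rewrite finset.in_setI => /andP[ix iy].
  have [ya yb /andP[yc yn]] := tripartite_pairsP k2 kn yP.
  move: (yP); rewrite !inE => -> /=; rewrite -!(inj_eq val_inj) /=.
  by case: (schur_tripleP xn ix) => iE; case: (schur_tripleP yn iy); lia.
apply: (leq_trans (subset_leq_card sub)).
have k34 : (k ^ 3 <= k ^ 4)%N by rewrite leq_exp2l.
have c1 : (#|Y1| <= k ^ 4)%N.
  apply: (@card_le_inj_range _ _ _ _ snd) => [y z|y] /finset.setIdP[yP /eqP yE].
    move=> /finset.setIdP[_ /eqP zE] yz.
    by rewrite (surjective_pairing y) (surjective_pairing z) yE zE yz.
  have [_ /andP[y2 ->] _] := tripartite_pairsP k2 kn yP.
  by rewrite andbT; exact: leq_ltn_trans y2.
have c2 : (#|Y2| <= k ^ 4)%N.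
  apply: (@card_le_inj_range _ _ _ _ fst) => [y z|y] /finset.setIdP[yP /eqP yE].
    move=> /finset.setIdP[_ /eqP zE] yz.
    by rewrite (surjective_pairing y) (surjective_pairing z) yE zE yz.
  have [/andP[y1 y1k] _ _] := tripartite_pairsP k2 kn yP.
  by rewrite (ltnW y1) (leq_trans (ltnW y1k)).
have c3 : (#|Y3| <= k ^ 4)%N.
  apply: (@card_le_inj_range _ _ _ _ fst) => [y z|y] /finset.setIdP[yP /eqP yE].
    move=> /finset.setIdP[_ /eqP zE] yz.
    rewrite (surjective_pairing y) (surjective_pairing z) yz; congr pair.
    apply: val_inj => /=; apply/eqP; have [/andP[/ltnW y1 _] _ _] := tripartite_pairsP k2 kn yP.
    by rewrite -(@eqn_pmul2l y.1) // yE yz zE.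
  have [/andP[y1 y1k] _ _] := tripartite_pairsP k2 kn yP.
  by rewrite (ltnW y1) (leq_trans (ltnW y1k)).
have := (leq_card_setU (Y1 :|: Y2)%SET Y3).1; have := (leq_card_setU Y1 Y2).1; lia.
Qed.

(** For fixed [a] the number of [b] is at least [k^6 / a - 1 - k^3]. The sum of [1 / a] is at least
    [ln (k^3) - ln (k^2) = ln k], and the errors total at most [(1 + k^3)(k^3 - k^2) <= 2 k^6]. *)
Lemma card_tripartite_pairs (R : realType) (n k : nat) :
  (2 <= k)%N -> (k ^ 6 <= n)%N ->
  k%:R ^+ 6 * (ln k%:R - 2) <= #|tripartite_pairs n k|%:R :> R.
Proof.
move=> k2 kn; have k0R : 0 < k%:R :> R by rewrite ltr0n; lia.
have k23 : (0 < k ^ 2 <= k ^ 3)%N by rewrite expn_gt0 leq_exp2l //; lia.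
have k36 : (k ^ 3 <= k ^ 6)%N by rewrite leq_exp2l //; lia.
pose F (a : nat) : R := k%:R ^+ 6 * a%:R^-1 - (1 + k%:R ^+ 3).
apply: (@le_trans _ _ (\sum_(k ^ 2 <= a < k ^ 3) F a)).
  rewrite sumrB -mulr_sumr sumr_const_nat.
  have := @ln_le_sum_inv R _ _ k23.
  rewrite !natrX !lnXn // => H.
  have H1 : ln k%:R <= \sum_(k ^ 2 <= i < k ^ 3) i%:R^-1 :> R by apply: le_trans H; lra.
  have k6 : 0 <= k%:R ^+ 6 :> R by rewrite exprn_ge0 // ltW.
  have := ler_wpM2l k6 H1.
  have : (1 + k%:R ^+ 3) *+ (k ^ 3 - k ^ 2) <= 2 * k%:R ^+ 6 :> R.
    have : ((1 + k ^ 3) * (k ^ 3 - k ^ 2) <= 2 * k ^ 6)%N.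
      have -> : (k ^ 6 = k ^ 3 * k ^ 3)%N by rewrite -expnD.
      by move: (k ^ 3)%N (k ^ 2)%N k23 => u v; nia.
    by rewrite -(ler_nat R) natrM natrD natrM !natrX mulr_natr.
  lra.
rewrite -(@sum_ord_range _ _ _ n.+1); last by lia.
rewrite /tripartite_pairs.
rewrite (@card_set_pairs _ _ (fun a b : 'I_n.+1 =>
  [&& k ^ 2 <= a, a < k ^ 3, k ^ 3 < b & a * b <= k ^ 6]%N)) natr_sum.
rewrite big_mkcond; apply: ler_sum => a _ /=; case: ifP => // /andP[a1 a2].
have a0 : (0 < a)%N by lia.
apply: (@le_trans _ _ #|[set b : 'I_n.+1 | (k ^ 3 < b <= k ^ 6 %/ a)%N]%SET|%:R); last first.
  rewrite ler_nat; apply/subset_leq_card/fintype.subsetP => b; rewrite !inE.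
  by rewrite a1 a2 leq_divRL // mulnC.
rewrite card_ord_range /F.
have lediv : (k ^ 6 %/ a <= n)%N by rewrite (leq_trans (leq_div _ _)).
have -> : (minn (k ^ 6 %/ a).+1 n.+1 - (k ^ 3).+1 = k ^ 6 %/ a - k ^ 3)%N by lia.
have : (k%:R ^+ 6 * a%:R^-1 <= (k ^ 6 %/ a)%:R + 1 :> R).
  rewrite ler_pdivrMr ?ltr0n // natr1 -natrX -natrM ler_nat.
  by have := ltn_ceil (k ^ 6) a0; lia.
have : (k ^ 6 %/ a)%:R <= (k ^ 6 %/ a - k ^ 3)%:R + k%:R ^+ 3 :> R.
  by rewrite -natrX -natrD ler_nat; lia.
lra.
Qed.

(** Avoiding all product triples implies avoiding the tripartite ones, and the latter have exactly
    three elements because [a < k^3 < b]. *)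
Lemma prob_product_schur_triple_second_moment (R : realType) (n k : nat) (p : R) :
  (2 <= k)%N -> (k ^ 6 <= n)%N -> 0 <= p <= 1 ->
  (1 - prob_random_subset (interval2 n) p (@has_product_schur_triple n))
    * (#|tripartite_pairs n k|%:R * p ^+ 3) ^+ 2
  <= #|tripartite_pairs n k|%:R * p ^+ 3
     + #|tripartite_pairs n k|%:R * (3 * k%:R ^+ 4) * p ^+ 5.
Proof.
move=> k2 kn hp.
have PS := fintype.subsetP (tripartite_pairs_schur k2 kn).
have -> : 3 * k%:R ^+ 4 = (3 * k ^ 4)%:R :> R by rewrite natrM natrX.
apply: le_trans; last first.
  apply: (@prob_random_subset_second_moment R _ _ (interval2 n) p _
    (@schur_triple n) (3 * k ^ 4) hp).
  - by move=> x /PS; exact: schur_triple_sub.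
  - move=> x xP; rewrite card_schur_triple ?PS //.
    have [xa xb _] := tripartite_pairsP k2 kn xP.
    suff -> : x.1 != x.2 by [].
    by apply/eqP => /(congr1 val) /=; lia.
  - by move=> x y; exact: tripartite_pairs_linear.
  - by move=> x; exact: card_tripartite_neighbours.
apply: ler_wpM2r; first exact: sqr_ge0.
rewrite prob_random_subsetC opprB addrC subrK.
apply: prob_random_subset_le => // B BA; apply: contra => /exists_inP[x xP xB].
by rewrite has_product_schur_tripleE //; apply/exists_inP; exists x; rewrite ?PS.
Qed.

(** * Choice of [k] and numerical estimates at the threshold *)

(** The condition [4 <= ln k] ensures that [ln k - 2], the factor in the count of tripartite pairs,
    is at least half of [ln k]. *)
Lemma near_nat_root6 (R : realType) : \forall n \near \oo,
  exists k : nat, [/\ (2 <= k)%N, (k ^ 6 <= n)%N, (n < k.+1 ^ 6)%N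
    & 4 <= ln (k%:R : R)].
Proof.
have [K0 _ HK0] := @nbhs_infty_ger R (expR 4).
pose K := maxn K0 2.
exists (K ^ 6)%N => // n /= Kn; have [k /andP[kn nk]] := @exists_nat_root 6 n isT.
have Kk : (K <= k)%N.
  by rewrite -ltnS -(@ltn_exp2r _ _ 6) //; exact: leq_ltn_trans nk.
exists k; split => //; first by apply: leq_trans Kk; rewrite leq_maxr.
have k0 : 0 < k%:R :> R by rewrite ltr0n; move: Kk; rewrite /K; lia.
rewrite -[leLHS](@expRK R) ler_ln ?posrE ?expR_gt0 //.
by apply: HK0 => /=; apply: leq_trans Kk; rewrite leq_maxl.
Qed.

(** The constant is [1536 = 64 * 12 * 2]: [n <= (2 k)^6] gives 64, [n <= (k^2)^6] gives
    [ln n <= 12 ln k], and [ln k <= 2 (ln k - 2)] gives the factor 2. *)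
Lemma card_tripartite_pairs_ge (R : realType) (n k : nat) :
  (2 <= k)%N -> (k ^ 6 <= n)%N -> (n < k.+1 ^ 6)%N -> 4 <= ln (k%:R : R) ->
  k%:R ^+ 6 <= #|tripartite_pairs n k|%:R :> R /\
  n%:R * ln n%:R <= 1536 * #|tripartite_pairs n k|%:R :> R.
Proof.
move=> k2 kn nk lnk; have N_ge := card_tripartite_pairs R k2 kn.
have k0 : 0 < k%:R :> R by rewrite ltr0n; lia.
have k6 : 0 < k%:R ^+ 6 :> R by rewrite exprn_gt0.
have n0 : 0 < n%:R :> R by apply: (lt_le_trans k6); rewrite -natrX ler_nat.
have n1 : 1 <= n%:R :> R by rewrite ler1n -(ltr0n R).
set N : R := #|_|%:R in N_ge *.
split; first by apply: le_trans N_ge; rewrite ler_peMr ?ltW //; lra.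
have nle : n%:R <= 64 * k%:R ^+ 6 :> R.
  rewrite -natrX -natrM ler_nat; apply: (leq_trans (ltnW nk)).
  have -> : 64%N = (2 ^ 6)%N by [].
  by rewrite -expnMn leq_exp2r //; lia.
have lnle : ln n%:R <= 12 * ln k%:R :> R.
  apply: (@le_trans _ _ (ln (k%:R ^+ 12))); last first.
    by rewrite lnXn // mulr_natl.
  rewrite ler_ln ?posrE ?exprn_gt0 // -natrX ler_nat; apply: (leq_trans (ltnW nk)).
  have -> : (k ^ 12 = (k ^ 2) ^ 6)%N by rewrite -expnM.
  by rewrite leq_exp2r //; rewrite expnS expn1; nia.
apply: (@le_trans _ _ ((64 * k%:R ^+ 6) * (12 * ln k%:R))).
  by apply: ler_pM => //; exact: ln_ge0.
have := ler_wpM2l (ltW k6) lnk; rewrite mulrBr in N_ge; lra.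
Qed.

(** The threshold is used later only through its positivity and this cube identity, which removes
    real powers from the estimates. *)
Lemma threshold_cube (R : realType) (x : R) : 0 < x ->
  0 < x `^ (- 3^-1) /\ (x `^ (- 3^-1)) ^+ 3 * x = 1.
Proof.
move=> x0; split; first exact: powR_gt0.
rewrite -powR_mulrn ?powR_ge0 // -powRrM mulNr mulVf ?pnatr_eq0 //.
by rewrite powRN powRr1 ?ltW // mulVf // gt_eqF.
Qed.

Lemma near_ln_ge1 (R : realType) : \forall n \near \oo,
  (0 < n)%N /\ 1 <= ln (n%:R : R).
Proof.
near=> n.
have en : expR 1 <= n%:R :> R by near: n; exact: nbhs_infty_ger.
have n0 : 0 < n%:R :> R := lt_le_trans (expR_gt0 1) en.
split; first by rewrite -(ltr0n R).
by rewrite -[leLHS](@expRK R) ler_ln ?posrE ?expR_gt0.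
Unshelve. all: by end_near. Qed.

Lemma first_moment_small (R : realType) (n s : nat) (p t e : R) :
  (s ^ 2 <= n)%N -> 1 <= ln (n%:R : R) -> 0 < n%:R :> R ->
  0 < e <= 1 -> 0 <= p -> 0 < t ->
  t ^+ 3 * (n%:R * ln n%:R) = 1 -> p <= e * t ->
  n%:R * ln n%:R * p ^+ 3 + s%:R * p ^+ 2 <= 2 * e.
Proof.
move=> sn ln1 n0 /andP[e0 e1] p0 t0; set L : R := n%:R * _ => tL pet.
have nL : n%:R <= L by rewrite /L ler_peMr // ltW.
have L0 : 0 < L := lt_le_trans n0 nL.
have e21 : e ^+ 2 <= 1 by rewrite exprn_ile1 // ltW.
have e2e : e ^+ 2 <= e by rewrite expr2 ler_piMr // ltW.
have e3e : e ^+ 3 <= e by rewrite exprS ler_piMr // ltW.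
have p2 : p ^+ 2 <= e ^+ 2 * t ^+ 2.
  by rewrite -exprMn lerXn2r ?nnegrE // mulr_ge0 ?ltW.
have p3 : p ^+ 3 <= e ^+ 3 * t ^+ 3.
  by rewrite -exprMn lerXn2r ?nnegrE // mulr_ge0 ?ltW.
(* Compare cubes: [s^3 <= s^4 <= n^2 <= L^2], while [L^2 t^6 = 1]. *)
have ts : s%:R * t ^+ 2 <= 1.
  rewrite -(@ler_pXn2r _ 3) ?nnegrE ?mulr_ge0 ?exprn_ge0 ?(ltW t0) // expr1n.
  have -> : (s%:R * t ^+ 2) ^+ 3 = s%:R ^+ 3 * (t ^+ 3) ^+ 2 by ring.
  apply: (@le_trans _ _ (L ^+ 2 * (t ^+ 3) ^+ 2)); last first.
    by rewrite -exprMn mulrC in tL *; rewrite tL expr1n.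
  apply: ler_wpM2r; first exact: sqr_ge0.
  apply: (@le_trans _ _ (n%:R ^+ 2)); last by rewrite lerXn2r ?nnegrE // ltW.
  rewrite -!natrX ler_nat; apply: (@leq_trans ((s ^ 2) ^ 2)).
    by case: (s) => // s'; rewrite -expnM leq_pexp2l.
  by rewrite leq_exp2r.
have s0 : 0 <= s%:R :> R by [].
have A : L * p ^+ 3 <= e ^+ 3.
  apply: le_trans (ler_wpM2l (ltW L0) p3) _.
  by rewrite mulrCA [L * _]mulrC tL mulr1.
have B : s%:R * p ^+ 2 <= e ^+ 2.
  apply: le_trans (ler_wpM2l s0 p2) _.
  by rewrite mulrCA ler_piMr // exprn_ge0 // ltW.
lra.
Qed.

(** Here [q] stands for the probability of no triple, [K] for [k], [N] for the number of tripartite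
    pairs and [L] for [n ln n]. Dividing by [(N p^3)^2] leaves [1 / (N p^3)], at most [1536 e] by
    [A], and [3 K^4 / (N p)], at most [36 e] by [C]. *)
Lemma second_moment_small (R : realType) (q N K p t e L : R) :
  0 < K -> K ^+ 6 <= N -> L <= 1536 * N -> 0 < t -> t ^+ 3 * L = 1 ->
  0 < e <= 1 -> t <= e * p ->
  q * (N * p ^+ 3) ^+ 2 <= N * p ^+ 3 + N * (3 * K ^+ 4) * p ^+ 5 ->
  q <= 1572 * e.
Proof.
move=> K0 KN LN t0 tL /andP[e0 e1] tep.
have N0 : 0 < N by apply: lt_le_trans KN; rewrite exprn_gt0.
have p0 : 0 < p by rewrite -(pmulr_rgt0 _ e0); exact: lt_le_trans tep.
have Np0 : 0 < N * p ^+ 3 by rewrite mulr_gt0 // exprn_gt0.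
have e3e : e ^+ 3 <= e.
  by rewrite exprS ler_piMr ?(ltW e0) // exprn_ile1 // ltW.
have t3 : t ^+ 3 <= e ^+ 3 * p ^+ 3.
  by rewrite -exprMn lerXn2r ?nnegrE ?mulr_ge0 ?(ltW e0) ?(ltW p0) ?(ltW t0).
have t30 : 0 < t ^+ 3 by rewrite exprn_gt0.
have A : 1 <= 1536 * e * (N * p ^+ 3).
  rewrite -[leLHS]tL; apply: (@le_trans _ _ (t ^+ 3 * (1536 * N))).
    by apply: ler_wpM2l => //; exact: ltW.
  rewrite (_ : 1536 * e * (N * p ^+ 3) = (e * p ^+ 3) * (1536 * N)); last by ring.
  apply: ler_wpM2r; first by rewrite mulr_ge0 ?ler0n ?(ltW N0).
  by apply: (le_trans t3); rewrite ler_wpM2r // exprn_ge0 // ltW.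
(* Compare cubes: [K^12 <= N^2 = N^2 t^3 L <= 1536 N^3 t^3], and 12 is chosen because
   [12^3 = 1728 >= 1536]. *)
have B : K ^+ 4 <= 12 * (N * t).
  rewrite -(@ler_pXn2r _ 3) ?nnegrE ?mulr_ge0 ?exprn_ge0 ?(ltW t0) ?(ltW N0) ?(ltW K0) //.
  have K12 : (K ^+ 6) ^+ 2 <= N ^+ 2.
    by rewrite lerXn2r ?nnegrE ?exprn_ge0 ?(ltW K0) ?(ltW N0).
  rewrite (_ : (K ^+ 4) ^+ 3 = (K ^+ 6) ^+ 2 * (t ^+ 3 * L)); last first.
    by rewrite tL mulr1 -!exprM.
  apply: (@le_trans _ _ (N ^+ 2 * (t ^+ 3 * (1536 * N)))).
    apply: ler_pM => //; first exact: sqr_ge0.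
    - by rewrite tL.
    - by rewrite ler_wpM2l // ltW.
  rewrite (_ : N ^+ 2 * (t ^+ 3 * (1536 * N)) = 1536 * (N ^+ 3 * t ^+ 3)); last by ring.
  rewrite (_ : (12 * (N * t)) ^+ 3 = 1728 * (N ^+ 3 * t ^+ 3)); last by ring.
  apply: ler_wpM2r; first by rewrite mulr_ge0 ?exprn_ge0 ?(ltW N0) ?(ltW t0).
  by rewrite ler_nat.
have C : 3 * K ^+ 4 * p ^+ 2 <= 36 * e * (N * p ^+ 3).
  rewrite (_ : 36 * e * (N * p ^+ 3) = 3 * (12 * (N * (e * p))) * p ^+ 2); last by ring.
  apply: ler_wpM2r; first exact: sqr_ge0.
  apply: ler_wpM2l => //; apply: (le_trans B); apply: ler_wpM2l => //.
  by apply: ler_wpM2l => //; exact: ltW.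
have -> : N * p ^+ 3 + N * (3 * K ^+ 4) * p ^+ 5
   = (1 + 3 * K ^+ 4 * p ^+ 2) * (N * p ^+ 3) by ring.
rewrite expr2 mulrA (ler_pM2r Np0) => H.
rewrite -(ler_pM2r Np0); apply: (le_trans H).
rewrite (_ : 1572 * e * (N * p ^+ 3) =
  1536 * e * (N * p ^+ 3) + 36 * e * (N * p ^+ 3)); last by ring.
exact: lerD.
Qed.

(** * Passage to the two limits *)

Theorem theorem1p3 (R : realType) (p : nat -> R)
    (hp : forall n : nat, 0 <= p n <= 1) :
  let t : nat -> R := fun n => (n%:R * ln n%:R) `^ (- 3^-1) in
  let Pr : nat -> R := fun n =>
    prob_random_subset (interval2 n) (p n) (@has_product_schur_triple n) in
  (p =o_\oo t -> Pr n @[n --> \oo] --> (0 : R)) /\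
  (t =o_\oo p -> Pr n @[n --> \oo] --> (1 : R)).
Proof.
move=> t Pr.
have Pr0 n : 0 <= Pr n by exact: prob_random_subset_ge0.
(* The cube identity fails for [n <= 1], where [n ln n = 0], so it is stated eventually. *)
have tcube : \forall n \near \oo, [/\ (0 < n)%N, 1 <= ln (n%:R : R), 0 < t n
    & t n ^+ 3 * (n%:R * ln n%:R) = 1].
  apply: filterS (near_ln_ge1 R) => n [n0 ln1].
  have n0R : 0 < n%:R :> R by rewrite ltr0n.
  have [] // := @threshold_cube R (n%:R * ln n%:R).
  by rewrite mulr_gt0 // (lt_le_trans ltr01).
split => /eqoP ho; apply/cvgrPdist_le => e0 e0_gt0.
  (* The cap at 1 allows higher powers of [e] to be bounded by [e]; the divisor 2 matches the bound
     [2 * e] of [first_moment_small]. *)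
  pose e := Num.min 1 (e0 / 2).
  have e_gt0 : 0 < e by rewrite lt_min ltr01 divr_gt0.
  have e1 : e <= 1 by rewrite ge_min lexx.
  have ee0 : e <= e0 / 2 by rewrite ge_min lexx orbT.
  near=> n.
  have [n0 ln1 tn0 tn3] : [/\ (0 < n)%N, 1 <= ln (n%:R : R), 0 < t n
    & t n ^+ 3 * (n%:R * ln n%:R) = 1] by near: n.
  have /andP[p0 p1] := hp n.
  have pt : p n <= e * t n.
    by rewrite -[p n]ger0_norm // -[t n]gtr0_norm //; near: n; exact: ho.
  rewrite sub0r normrN ger0_norm //.
  have [s sn Prs] := prob_product_schur_triple_le n0 (hp n).
  apply: (le_trans Prs); apply: (@le_trans _ _ (2 * e)); last by lra.
  apply: first_moment_small sn _ _ _ _ tn0 tn3 pt => //; first by rewrite ltr0n.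
  by rewrite e_gt0.
(* The divisor matches the bound [1572 * e] of [second_moment_small]. *)
pose e := Num.min 1 (e0 / 1572).
have e_gt0 : 0 < e by rewrite lt_min ltr01 divr_gt0 ?ltr0n.
have e1 : e <= 1 by rewrite ge_min lexx.
have ee0 : e <= e0 / 1572 by rewrite ge_min lexx orbT.
near=> n.
have [n0 ln1 tn0 tn3] : [/\ (0 < n)%N, 1 <= ln (n%:R : R), 0 < t n
  & t n ^+ 3 * (n%:R * ln n%:R) = 1] by near: n.
have /andP[p0 p1] := hp n.
have tp : t n <= e * p n.
  by rewrite -[p n]ger0_norm // -[t n]gtr0_norm //; near: n; exact: ho.
have [k [k2 kn nk lnk]] : exists k : nat, [/\ (2 <= k)%N, (k ^ 6 <= n)%N,
    (n < k.+1 ^ 6)%N & 4 <= ln (k%:R : R)] by near: n; exact: near_nat_root6.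
have [KN LN] := card_tripartite_pairs_ge k2 kn nk lnk.
have q0 : 0 <= 1 - Pr n.
  rewrite /Pr prob_random_subsetC opprB addrC subrK.
  exact: prob_random_subset_ge0.
rewrite ger0_norm //; apply: (@le_trans _ _ (1572 * e)); last by lra.
apply: second_moment_small KN LN tn0 tn3 _ tp
  (prob_product_schur_triple_second_moment k2 kn (hp n)).
  by rewrite ltr0n (leq_trans _ k2).
by rewrite e_gt0.
Unshelve. all: by end_near. Qed.
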